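(* Let $S$ be a finite semigroup, and let $\mathcal A(S) = (S, Q(S), \iota, \cdot)$ be the automaton defined in the context (for any choice of the idempotents $E_X$ and of the permutations $g_{(s,R)}$). Then the transition semigroup of $\mathcal A(S)$, i.e. the semigroup of functions $Q(S)\to Q(S)$ generated by the functions $q\mapsto q\cdot s$ ($s\in S$), belongs to $\mathbf{ER}$, the pseudovariety of finite semigroups $T$ for which $\langle E(T)\rangle$ is $\mathcal R$-trivial.
   Context: Maps are written on the right. For a finite semigroup $T$: $T^I$ is $T$ with a new identity element $I$ adjoined; $E(T)$ is the set of idempotents; $x^\omega$ is the unique idempotent power of $x$; $x\le_{\mathcal R}y$ iff $x\in yT^I$, $<_{\mathcal R}$ is its strict version, and $\mathcal R$ the induced equivalence, with $R_x$ the $\mathcal R$-class of $x$; $J_x$ is the $\mathcal J$-class of $x$. $K_{\mathbf G}(T)$ (group kernel) is the set of $x\in T$ such that $(x,1_G)\in\rho$ for every finite group $G$ and every subsemigroup $\rho\subseteq T\times G$ projecting onto $T$. Type-II partition on $T$: $x\equiv_{\mathrm{II}}y$ iff $xa=y$, $yb=x$ for some $a,b\in K_{\mathbf G}(T)^I$; $[x]_{\mathrm{II}}$ is the class of $x$. It is contained in $\mathcal R$. For an $\mathcal R$-class $R$, $R/\mathrm{II}$ is the set of type-II classes in $R$, on which $T$ acts by partial injections: $[x]_{\mathrm{II}}\ast s=[x's]_{\mathrm{II}}$ if some $x'\equiv_{\mathrm{II}}x$ has $x's\in R$, and undefined otherwise (this is well defined). Right activator: for a $\mathcal J$-class $J$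 of $T$, $\mathrm{RAct}(J)$ is the unique $\le_{\mathcal J}$-minimal $\mathcal J$-class of $T^I$ contained in $\{a\in T^I: Ja\cap J\ne\varnothing\}$. For $x\in T$, $\mathcal F_x$ is the set of $t\in\mathrm{RAct}(J_x)$ such that (1) $xt=x$; (2) for all $s\in T$, $xs<_{\mathcal R}x$ iff $ts<_{\mathcal R}t$; (3) left multiplication by $x$ maps $R_t$ onto $R_x$. $\mathcal F_x$ always contains an idempotent. Let $S$ be a finite semigroup. $\mathcal P(S)$ is the semigroup of non-empty subsets of $S$ under setwise product. An $S$-complex is a subsemigroup of $\mathcal P(S)$ containing all singletons and closed under non-empty subsets of members. $C=\mathsf C_{\mathbf{ER}}(S)$ is the intersection of all $S$-complexes $\mathcal K$ such that $\bigcup[E]_{\mathrm{II}}\in\mathcal K$ for every idempotent $E$ of the semigroup $\mathcal K$, with $[E]_{\mathrm{II}}$ computed in $\mathcal K$; it is itself the smallest such complex. For $X\in C$, $(X)\beta=\bigcup[X]_{\mathrm{II}}$ (class computed in the semigroup $C$), which lies in $C$; also $(I)\beta=I$. For each $X\in C$ choose an idempotent $E_X\in\mathcal F_X$ (computed in $C$), with $E_F=F$ if $F$ is idempotent, and put $(X)\psi=X\cdot((E_X)\beta)^\omega$. Let $\overline X=(X)\psi^\omega$, where $\psi^\omega$ is the idempotent power of the self-map $\psi$ of $C$. Let $\mathbb F=\{X\in C:(X)\psi=X\}$ and $\mathbb B=\{[X]_{\mathrm{II}}:X\in\mathbb F\}=\{\pi\in C/\mathrm{II}:\bigcup\pi\in\pi\}$.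 Groups: for each $\mathcal R$-class $R$ of $C$ and $s\in S$, choose a permutation $g_{(s,R)}$ of $R/\mathrm{II}$ extending the partial injection $[X]_{\mathrm{II}}\mapsto[X]_{\mathrm{II}}\ast\{s\}$. Let $\mathscr R=\{R_X:X\in\mathbb F\}$, $g_s=(g_{(s,R)})_{R\in\mathscr R}$, and let $\mathbb G$ be the (finite) group generated by $\{g_s : s\in S\}$ in the product over $R\in\mathscr R$ of the symmetric groups on $R/\mathrm{II}$. $\mathbb G$ acts on the right on $\bigcup_{R\in\mathscr R}R/\mathrm{II}$ componentwise, written $[X]_{\mathrm{II}}\odot g$. Automaton: $Q(S)=\{(X,d,g)\in\mathbb F\times\mathbb G\times\mathbb G:[X]_{\mathrm{II}}\odot d^{-1}g\in\mathbb B\}\cup\{\iota\}$ with initial state $\iota$. For $(X,d,g)\in Q(S)\setminus\{\iota\}$, set $\mathrm{val}(X,d,g)=\bigcup([X]_{\mathrm{II}}\odot d^{-1}g)\in\mathbb F$. For $s\in S$ define $\lambda_s:Q(S)\setminus\{\iota\}\to\mathbb F\times\mathbb G$ by $(X,d,g)\lambda_s=(X,d)$ if $\mathrm{val}(X,d,g)\cdot\{s\}\ \mathcal R\ \mathrm{val}(X,d,g)$ in $C$ and $(X,d,gg_s)\in Q(S)$, and $(X,d,g)\lambda_s=(\overline{\mathrm{val}(X,d,g)\cdot\{s\}},\,gg_s)$ otherwise. The transitions are $\iota\cdot s=(\overline{\{s\}},g_s,g_s)$ and $(X,d,g)\cdot s=((X,d,g)\lambda_s,\,gg_s)$, which always lie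 in $Q(S)\setminus\{\iota\}$. *)

(* Defs.v *)
From HB Require Import structures.
From mathcomp Require Import all_boot all_fingroup all_solvable.
From mathcomp Require Import boolp.

Set Implicit Arguments.
Unset Strict Implicit.
Unset Printing Implicit Defensive.

Reserved Notation "x ** y" (at level 40, left associativity).
Reserved Notation "x **I a" (at level 40, left associativity).

(* The library's semigroupType cannot be joined with finType once
   finGroupType is loaded, hence this separate structure. *)
HB.mixin Record Finite_isSemigroup T of Finite T := {
  smul : T -> T -> T;
  smulA : associative smul
}.

#[short(type="finSemigroupType")]
HB.structure Definition FinSemigroup := {T of Finite_isSemigroup T & Finite T}.

Declare Scope sg_scope.
Delimit Scope sg_scope with sg.
Notation "x ** y" := (smul x y) : sg_scope.
Local Open Scope sg_scope.

(* adjI T is T^I; the new identity I is None, and T embeds by Some. *)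
Definition adjI (T : Type) : Type := option T.
HB.instance Definition _ (T : finType) := Finite.on (adjI T).

Section AdjI.
Variable T : finSemigroupType.

Definition adjI_mul (a b : adjI T) : adjI T :=
  match a, b with
  | Some x, Some y => Some (x ** y)
  | Some _, None => a
  | None, _ => b
  end.

Lemma adjI_mulA : associative adjI_mul.
Proof. by case=> [x|] [y|] [z|] //=; rewrite smulA. Qed.

HB.instance Definition _ := Finite_isSemigroup.Build (adjI T) adjI_mulA.

Definition mulI (x : T) (a : adjI T) : T := if a is Some y then x ** y else x.

End AdjI.

Notation "x **I a" := (mulI x a) : sg_scope.

(* tfun Q is the semigroup of all self-maps of Q, acting on the right:
   f ** g is f followed by g. *)
Definition tfun (Q : finType) : Type := {ffun Q -> Q}.
HB.instance Definition _ (Q : finType) := Finite.on (tfun Q).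

Section TFun.
Variable Q : finType.

Definition tapp (f : tfun Q) : Q -> Q := fun_of_fin f.
Definition tmk (f : Q -> Q) : tfun Q := [ffun q => f q].
Definition tfun_mul (f g : tfun Q) : tfun Q := tmk (fun q => tapp g (tapp f q)).

Lemma tfun_mulA : associative tfun_mul.
Proof. by move=> f g h; apply/ffunP=> q; rewrite /tapp !ffunE /tapp !ffunE. Qed.

HB.instance Definition _ := Finite_isSemigroup.Build (tfun Q) tfun_mulA.
End TFun.

Section SetMul.
Variable S : finSemigroupType.

Definition set_smul (A B : {set S}) : {set S} := [set x ** y | x in A, y in B].

Lemma set_smulA : associative set_smul.
Proof.
move=> A B D; apply/setP=> w; apply/imset2P/imset2P.
- case=> x _ Ax /imset2P[y z By Dz ->] ->.
  by exists (x ** y) z; rewrite ?smulA //; apply: imset2_f.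
- case=> _ z /imset2P[x y Ax By ->] Dz ->.
  by exists x (y ** z); rewrite ?smulA //; apply: imset2_f.
Qed.

HB.instance Definition _ := Finite_isSemigroup.Build {set S} set_smulA.
End SetMul.

Section SubSemigroups.
Variable T : finSemigroupType.

Definition sg_closed (A : {set T}) : bool :=
  [forall x in A, forall y in A, x ** y \in A].

Record subsg : Type := SubSg { sgset :> {set T}; sgsetP : sg_closed sgset }.

Lemma sg_closedP (A : {set T}) :
  reflect (forall x y, x \in A -> y \in A -> x ** y \in A) (sg_closed A).
Proof.
apply: (iffP forall_inP) => [H x y Ax Ay | H x Ax].
  by move/forall_inP: (H x Ax); apply.
by apply/forall_inP=> y; apply: H.
Qed.

Lemma subsgM (K : subsg) x y : x \in sgset K -> y \in sgset K -> x ** y \in sgset K.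
Proof. exact: (sg_closedP _ (sgsetP K)). Qed.

Definition sg_type (K : subsg) : Type := {x : T | x \in sgset K}.
HB.instance Definition _ (K : subsg) := SubFinite.on (sg_type K).

Section SgType.
Variable K : subsg.

Definition sg_mul (x y : sg_type K) : sg_type K :=
  exist _ (val x ** val y) (subsgM (valP x) (valP y)).

Lemma sg_mulA : associative sg_mul.
Proof. by move=> x y z; apply: val_inj; rewrite /= smulA. Qed.

HB.instance Definition _ := Finite_isSemigroup.Build (sg_type K) sg_mulA.
End SgType.

Definition gen_set (A : {set T}) : {set T} :=
  \bigcap_(B : {set T} | sg_closed B && (A \subset B)) B.

Lemma gen_set_closed (A : {set T}) : sg_closed (gen_set A).
Proof.
apply/sg_closedP=> x y /bigcapP Hx /bigcapP Hy; apply/bigcapP=> B HB.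
case/andP: (HB) => /sg_closedP cB _.
by apply: cB; [apply: Hx | apply: Hy].
Qed.

Definition gen_sg (A : {set T}) : subsg := SubSg (gen_set_closed A).

End SubSemigroups.

Section Green.
Variable T : finSemigroupType.
Implicit Types (x y : T).

Definition leR x y : bool := [exists a : adjI T, x == y **I a].
Definition eqR x y : bool := leR x y && leR y x.
Definition ltR x y : bool := leR x y && ~~ leR y x.
Definition Rclass x : {set T} := [set y | eqR y x].

Definition leJ x y : bool :=
  [exists a : adjI T, exists b : adjI T, Some x == a ** Some y ** b :> adjI T].
Definition eqJ x y : bool := leJ x y && leJ y x.
Definition Jclass x : {set T} := [set y | eqJ y x].

Definition sg_idem x : bool := x ** x == x.

(* spow x n is x^(n+1). *)
Definition spow x (n : nat) : T := iter n (smul x) x.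

Lemma spowD x m n : spow x m ** spow x n = spow x (m + n).+1.
Proof. by elim: m => //= m IH; rewrite -smulA IH. Qed.

Lemma ex_idem_pow x : exists n, sg_idem (spow x n).
Proof.
have /injectivePn [i [j neq_ij eq_ij]] :
    ~~ injectiveb (fun i : 'I_#|T|.+1 => spow x i).
  by apply/negP=> /injectiveP/leq_card; rewrite card_ord ltnn.
wlog lt_ij : i j neq_ij eq_ij / i < j.
  move=> W; case: (ltngtP i j) => [|lt|/val_inj e].
  - exact: W.
  - by apply: (W j i) => //; rewrite eq_sym.
  - by rewrite e eqxx in neq_ij.
have perS m : spow x (m + j) = spow x (m + i).
  by case: m => [|m]; rewrite ?add0n // !addSn -!spowD eq_ij.
have per m k : i <= m -> spow x (m + k * (j - i)) = spow x m.
  move=> le_im; elim: k => [|k IH]; first by rewrite mul0n addn0.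
  rewrite mulSn addnCA -[RHS]IH.
  have le_i := leq_trans le_im (leq_addr (k * (j - i)) m).
  rewrite -[in RHS](subnK le_i) -perS; congr (spow x _).
  by rewrite addnC -{1}(subnK le_i) -addnA subnKC // ltnW.
pose p := j - i; have p_gt0 : 0 < p by rewrite subn_gt0.
have Hm : 0 < p * i.+1 by rewrite muln_gt0 p_gt0.
exists (p * i.+1).-1; rewrite /sg_idem spowD.
have -> : ((p * i.+1).-1 + (p * i.+1).-1).+1 = (p * i.+1).-1 + i.+1 * p.
  by rewrite -addnS prednK // [i.+1 * p]mulnC.
rewrite per // -ltnS prednK //; exact: leq_pmull.
Qed.

Definition omega x : T := spow x (ex_minn (ex_idem_pow x)).

Lemma omega_idem x : sg_idem (omega x).
Proof. by rewrite /omega; case: ex_minnP. Qed.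

Definition idempotents : {set T} := [set e | sg_idem e].

Definition R_trivial : Prop := forall x y, eqR x y -> x = y.

End Green.

Definition in_ER (T : finSemigroupType) : Prop :=
  R_trivial (sg_type (gen_sg (idempotents T))).

Section TypeII.
Variable T : finSemigroupType.
Implicit Types (x y : T).

Definition group_kernel : {set T} :=
  [set x | `[< forall (G : finGroupType) (rho : {set T * G}),
      (forall y z g h, (y, g) \in rho -> (z, h) \in rho ->
         (y ** z, (g * h)%g) \in rho) ->
      (forall y, exists g, (y, g) \in rho) ->
      (x, 1%g) \in rho >]].

Definition group_kernelI : {set adjI T} :=
  None |: [set (Some x : adjI T) | x in group_kernel].

Definition eqII x y : bool :=
  [exists a in group_kernelI, exists b in group_kernelI,
     (x **I a == y) && (y **I b == x)].

Definition classII x : {set T} := [set y | eqII x y].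

Definition quotII (R : {set T}) : {set {set T}} := [set classII x | x in R].

Lemma group_kernelP x :
  reflect (forall (G : finGroupType) (rho : {set T * G}),
      (forall y z g h, (y, g) \in rho -> (z, h) \in rho ->
         (y ** z, (g * h)%g) \in rho) ->
      (forall y, exists g, (y, g) \in rho) ->
      (x, 1%g) \in rho) (x \in group_kernel).
Proof. by rewrite inE; apply: asboolP. Qed.

Lemma eqII_refl x : eqII x x.
Proof.
have N : None \in group_kernelI by rewrite !inE.
by apply/exists_inP; exists None => //; apply/exists_inP; exists None; rewrite //= !eqxx.
Qed.

Lemma group_kernelM x y :
  x \in group_kernel -> y \in group_kernel -> x ** y \in group_kernel.
Proof.
move=> /group_kernelP kx /group_kernelP ky; apply/group_kernelP=> G rho cl onto.
by have := cl _ _ _ _ (kx G rho cl onto) (ky G rho cl onto); rewrite mulg1.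
Qed.

Lemma group_kernel_weak u k :
  k \in group_kernel -> u ** k ** u = u -> u \in group_kernel.
Proof.
move=> /group_kernelP kk uku; apply/group_kernelP=> G rho cl onto.
have [g ug] := onto u.
have pow n : (u, (g ^+ n.+1)%g) \in rho.
  elim: n => [|n IH]; first by rewrite expg1.
  have := cl _ _ _ _ (cl _ _ _ _ IH (kk G rho cl onto)) ug.
  by rewrite uku mulg1 -expgSr.
by rewrite -(expg_order g) -(prednK (order_gt0 g)); apply: pow.
Qed.

Lemma group_kernel_idem e : sg_idem e -> e \in group_kernel.
Proof.
move=> /eqP ee; apply/group_kernelP=> G rho cl onto; have [g eg] := onto e.
have pow n : (e, (g ^+ n.+1)%g) \in rho.
  elim: n => [|n IH]; first by rewrite expg1.
  by have := cl _ _ _ _ IH eg; rewrite ee -expgSr.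
by rewrite -(expg_order g) -(prednK (order_gt0 g)); apply: pow.
Qed.

(* Graph of the partial action of T on R/II: p * s is defined and equals q. *)
Definition actII (R p : {set T}) (s : T) (q : {set T}) : bool :=
  [exists x in p, (x ** s \in R) && (q == classII (x ** s))].

End TypeII.

Section Activators.
Variable T : finSemigroupType.

Definition right_stab (J : {set T}) : {set adjI T} :=
  [set a | [set x **I a | x in J] :&: J != set0].

(* The elements of T^I lying in a J-class that is minimal among those contained
   in right_stab J; there is exactly one such class. *)
Definition RAct (J : {set T}) : {set adjI T} :=
  [set a | (Jclass a \subset right_stab J) &&
     [forall b : adjI T, (Jclass b \subset right_stab J) && leJ b a ==> leJ a b]].

Definition Fset (x : T) : {set adjI T} :=
  [set t in RAct (Jclass x) |
    [&& x **I t == x,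
        [forall s : T, ltR (x ** s) x == ltR (t ** Some s) t]
      & [set x **I u | u in Rclass t] == Rclass x]].

Lemma Fset_classII x t y : t \in Fset x -> sg_idem t -> eqII x y ->
  y = x \/ exists2 e, t = Some e & exists2 f, eqII e f & y = x ** f.
Proof.
rewrite inE => /andP[_ /and3P[/eqP xt /forallP ltE _]] idt.
case/exists_inP=> a + /exists_inP[b + /andP[/eqP <- /eqP]].
rewrite 2!inE => /orP[/eqP->|/imsetP[a0 ka ->]]; first by left.
rewrite 2!inE => /orP[/eqP->|/imsetP[b0 kb ->]] /=; first by left.
move=> xab; set h := a0 ** b0; pose n := ex_minn (ex_idem_pow h).
have xh0 : x ** h = x by rewrite smulA.
have xh m : x ** spow h m = x by elim: m => [|m IH] //=; rewrite smulA xh0.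
pose f := omega h; have xf : x ** f = x by exact: xh.
have tf : leR t (t ** Some f).
  have := ltE f; rewrite xf /ltR andbN eq_sym eqbF_neg negb_and negbK.
  case/orP=> // /negP[]; apply/existsP; by exists (Some (Some f : adjI T)).
case: t idt xt tf {ltE} => [e|] idt xt tf; last first.
  by case/existsP: tf => -[[z|]|].
right; exists e => //; exists (e ** a0); last by rewrite smulA [x ** e]xt.
have ee : e ** e = e by case: (Some_inj (eqP idt)).
have [z ez] : exists z : adjI T, e = e ** f **I z.
  by case/existsP: tf => -[[z|]|] /eqP[ez]; [exists (Some z)|exists None|exists None].
pose u := if z is Some z0 then z0 ** e else e.
have eu : e ** f ** u = e.
  by rewrite /u; case: (z) ez => [z0|] /= ez; rewrite ?smulA -?ez ?ee // -[e ** f]ez ee.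
have ue : u ** e = u by rewrite /u; case: (z) => [z0|]; rewrite -?smulA ee.
have kef : e ** f \in group_kernel T.
  by apply: group_kernelM; apply: group_kernel_idem; [apply/eqP | apply: omega_idem].
have ku : u \in group_kernel T.
  by apply: group_kernel_weak kef _; rewrite -smulA eu ue.
pose c := if n is m.+1 then b0 ** spow h m ** u else b0 ** u.
have kh m : spow h m \in group_kernel T.
  by elim: m => [|m IH] /=; do ?apply: group_kernelM.
have kc : c \in group_kernel T.
  by rewrite /c; case: (n) => [|m]; do ?apply: group_kernelM.
have ac : a0 ** c = f ** u.
  by rewrite /c /f /omega -/n; case: (n) => [|m] /=; rewrite !smulA.
have inI (v : T) : v \in group_kernel T -> (Some v : adjI T) \in group_kernelI T.
  by move=> kv; rewrite 2!inE; apply/orP; right; apply: imset_f.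
apply/exists_inP; exists (Some a0 : adjI T); first exact: inI.
apply/exists_inP; exists (Some c : adjI T); first exact: inI.
by rewrite /= eqxx -smulA ac smulA eu eqxx.
Qed.

End Activators.

Section Complexes.
Variable S : finSemigroupType.

(* Subsemigroups of P(S) are the subsemigroups of {set S} avoiding set0. *)
Definition is_complex (K : subsg {set S}) : Prop :=
  [/\ set0 \notin sgset K,
      forall s : S, [set s] \in sgset K
    & forall A B : {set S},
        A \in sgset K -> B \subset A -> B != set0 -> B \in sgset K].

Definition unionII (K : subsg {set S}) (p : {set sg_type K}) : {set S} :=
  \bigcup_(X in p) val X.

Definition is_ER_complex (K : subsg {set S}) : Prop :=
  is_complex K /\
  forall E : sg_type K, sg_idem E -> unionII (classII E) \in sgset K.

Definition CER_set : {set {set S}} :=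
  [set A | `[< forall K : subsg {set S}, is_ER_complex K -> A \in sgset K >]].

Lemma CER_closed : sg_closed CER_set.
Proof.
apply/sg_closedP=> A B; rewrite !inE => /asboolP HA /asboolP HB.
by apply/asboolP=> K HK; apply: subsgM; [apply: HA | apply: HB].
Qed.

Definition CER : subsg {set S} := SubSg CER_closed.

Lemma CER_sing (s : S) : [set s] \in sgset CER.
Proof. by rewrite inE; apply/asboolP=> K [[_ + _] _]; apply. Qed.

Definition singC (s : S) : sg_type CER := exist _ [set s] (CER_sing s).

Lemma CER_sub (K : subsg {set S}) : is_ER_complex K ->
  forall A, A \in sgset CER -> A \in sgset K.
Proof. by move=> HK A; rewrite inE => /asboolP; apply. Qed.

Lemma CER_unionII (E : sg_type CER) :
  sg_idem E -> unionII (classII E) \in sgset CER.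
Proof.
move=> idE; rewrite inE; apply/asboolP=> K HK.
have [[nK0 _ downK] clK] := HK.
pose inc (X : sg_type CER) : sg_type K := exist _ (val X) (CER_sub HK (valP X)).
have incM X Y : inc (X ** Y) = inc X ** inc Y by apply: val_inj.
have kerI X : X \in group_kernel (sg_type CER) -> inc X \in group_kernel (sg_type K).
  move/group_kernelP=> kX; apply/group_kernelP=> G rho cl onto.
  have := kX G [set z | (inc z.1, z.2) \in rho].
  rewrite inE /=; apply=> [y z g h | y].
    by rewrite !inE /= incM; apply: cl.
  by have [g Hg] := onto (inc y); exists g; rewrite inE.
pose incI (a : adjI (sg_type CER)) : adjI (sg_type K) := omap inc a.
have kerII a : a \in group_kernelI (sg_type CER) ->
    incI a \in group_kernelI (sg_type K).
  rewrite 2!inE => /orP[/eqP->|/imsetP[X kX ->]]; rewrite 2!inE //=.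
  by apply/imsetP; exists (inc X) => //; apply: kerI.
have incMI X a : inc (X **I a) = inc X **I incI a
  by case: a => [Y|] //=; rewrite -incM.
have idI : sg_idem (inc E) by rewrite /sg_idem -incM (eqP idE) eqxx.
apply: downK (clK _ idI) _ _; last first.
  apply: contra nK0 => /eqP U0; have : val E \subset set0.
    by rewrite -U0 (bigcup_sup E) // inE eqII_refl.
  by rewrite subset0 => /eqP <-; apply: CER_sub (valP E).
apply/bigcupsP=> X; rewrite inE => /exists_inP[a ka /exists_inP[b kb]].
case/andP=> /eqP aE /eqP bE; apply: (bigcup_max (inc X)) => //.
rewrite inE; apply/exists_inP; exists (incI a); first exact: kerII.
apply/exists_inP; exists (incI b); first exact: kerII.
by rewrite -!incMI aE bE !eqxx.
Qed.

End Complexes.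

Lemma spow_Some (T : finSemigroupType) (x : T) n :
  spow (Some x : adjI T) n = Some (spow x n).
Proof. by elim: n => //= n ->. Qed.

Lemma spow_None (T : finSemigroupType) n : spow (None : adjI T) n = None.
Proof. by elim: n => //= n ->. Qed.

Lemma subsg_spow (T : finSemigroupType) (K : subsg T) x n :
  x \in sgset K -> spow x n \in sgset K.
Proof. by move=> Kx; elim: n => //= n IH; apply: subsgM. Qed.

Lemma set_smulS (S : finSemigroupType) (A A' B B' : {set S}) :
  A \subset A' -> B \subset B' -> A ** B \subset A' ** B'.
Proof.
move=> /subsetP sA /subsetP sB; apply/subsetP=> z /imset2P[x y Ax By ->].
by apply: imset2_f; [apply: sA | apply: sB].
Qed.

Lemma sub_mul_spow (S : finSemigroupType) (X E B : {set S}) n :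
  X ** E = X -> E \subset B -> X ** B \subset X ** spow B n.
Proof.
move=> XE sEB; elim: n => //= n IH; apply: subset_trans IH _.
by rewrite smulA set_smulS // -{1}XE set_smulS.
Qed.

Section Choices.
Variable S : finSemigroupType.
Local Notation C := (sg_type (CER S)).

Record idem_choice : Type := IdemChoice {
  EX : C -> adjI C;
  EX_Fset : forall X, EX X \in Fset X;
  EX_idem : forall X, sg_idem (EX X);
  EX_id : forall X, sg_idem X -> EX X = Some X
}.

(* A permutation of R/II is a permutation of {set C} supported on quotII R. *)
Record perm_choice : Type := PermChoice {
  gsR : S -> {set C} -> {perm {set C}};
  gsR_on : forall s X, perm_on (quotII (Rclass X)) (gsR s (Rclass X));
  gsR_ext : forall s X p q, p \in quotII (Rclass X) ->
    actII (Rclass X) p (singC s) q -> gsR s (Rclass X) p = q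
}.

End Choices.

Section Psi.
Variables (S : finSemigroupType) (E : idem_choice S).
Local Notation C := (sg_type (CER S)).

Definition beta (X : C) : {set S} := unionII (classII X).

Definition betaI (X : adjI C) : adjI {set S} := omap beta X.

(* The omega power is taken in {set S}^I; it is the same as in C^I. *)
Definition psi_set (X : C) : {set S} := val X **I omega (betaI (EX E X)).

Lemma idem_Some (T : finSemigroupType) (e : T) :
  sg_idem (Some e : adjI T) -> sg_idem e.
Proof. by move/eqP=> [ee]; apply/eqP. Qed.

Lemma sub_beta (X : C) : val X \subset beta X.
Proof. by apply: (bigcup_max X) => //; rewrite inE eqII_refl. Qed.

Lemma psi_setP (X : C) : psi_set X \in sgset (CER S).
Proof.
rewrite /psi_set /omega; case: (EX E X) (EX_idem E X) => [e|] He /=; last first.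
  by rewrite spow_None; apply: valP.
rewrite spow_Some; apply: (subsgM (K := CER S)); first exact: valP.
exact/subsg_spow/CER_unionII/idem_Some.
Qed.

Definition psi (X : C) : C := exist _ (psi_set X) (psi_setP X).

Definition overline (X : C) : C := tapp (omega (tmk psi)) X.

Definition FF : {set C} := [set X | psi X == X].

Definition BB : {set {set C}} := [set classII X | X in FF].

Definition RR : {set {set C}} := [set Rclass X | X in FF].

Lemma EX_fix (X : C) : X **I EX E X = X.
Proof. by have := EX_Fset E X; rewrite inE => /andP[_ /and3P[/eqP]]. Qed.

Lemma sub_psi (X : C) : val X \subset val (psi X).
Proof.
rewrite /= /psi_set /omega; have := EX_fix X.
case: (EX E X) => [e|] He /=; rewrite ?spow_None // spow_Some /=.
have He' : val X ** val e = val X by rewrite -[in RHS]He.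
apply: subset_trans (sub_mul_spow _ He' (sub_beta e)).
by have := set_smulS (subxx (val X)) (sub_beta e); rewrite He'.
Qed.

Lemma overline_FF (X : C) : overline X \in FF.
Proof.
rewrite /overline; set f := tmk psi; set w := omega f.
have appM (h k : tfun C) Y : tapp (h ** k) Y = tapp k (tapp h Y).
  by rewrite [LHS]/tapp ffunE.
have ww : tapp w (tapp w X) = tapp w X by rewrite -appM (eqP (omega_idem f)).
have fE Y : tapp f Y = psi Y by rewrite /tapp ffunE.
have sub_pow n (Y : C) : val Y \subset val (tapp (spow f n) Y).
  elim: n Y => [|n IH] Y /=; first by rewrite fE sub_psi.
  by rewrite appM fE; apply: subset_trans (sub_psi Y) (IH _).
set Z := tapp w X in ww *.
rewrite inE; apply/eqP/val_inj/eqP; rewrite eqEsubset sub_psi andbT.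
suff: val (psi Z) \subset val (tapp w Z) by rewrite ww.
rewrite /w /omega; case: ex_minn => [|n]; first by rewrite fE.
by rewrite [spow _ _]/= appM fE; exact: sub_pow.
Qed.

Lemma beta_FF (X : C) : X \in FF -> beta X = val X.
Proof.
rewrite inE => /eqP /(congr1 val) /= psiX.
apply/eqP; rewrite eqEsubset sub_beta andbT; apply/bigcupsP=> Y.
rewrite inE => /(Fset_classII (EX_Fset E X) (EX_idem E X)) [-> //|[e Ee]].
case=> f ef ->; have := EX_fix X; rewrite Ee => Xe.
have Xe' : val X ** val e = val X by rewrite -[in RHS]Xe.
suff: val X ** val f \subset psi_set X by rewrite psiX.
rewrite /psi_set Ee /omega spow_Some /=.
apply: subset_trans (sub_mul_spow _ Xe' (sub_beta e)).
by rewrite set_smulS //; apply: (bigcup_max f) => //; rewrite inE.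
Qed.

Lemma union_BB (p : {set C}) : p \in BB -> unionII p \in sgset (CER S).
Proof. by case/imsetP=> X FX ->; rewrite [unionII _]beta_FF // (valP X). Qed.

End Psi.

Section Automaton.
Variables (S : finSemigroupType) (E : idem_choice S) (c : perm_choice S).
Local Notation C := (sg_type (CER S)).

Definition RRtype : finType := {R : {set C} | R \in RR E}.
Definition permtype (R : RRtype) : finGroupType := {perm {set C}}.

Definition prodG : finGroupType := {dffun forall R : RRtype, permtype R}.

Definition gs (s : S) : prodG :=
  [ffun R : RRtype => gsR c s (val R) : permtype R].

Definition GG : {group prodG} := <<[set gs s | s : S]>>%G.

(* The sets quotII R are pairwise disjoint, so at most one R is eligible; the
   last branch is reached only by p outside the union of the R/II. *)
Definition odot (p : {set C}) (d : prodG) : {set C} :=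
  if [pick R : RRtype | p \in quotII (val R)] is Some R
  then (d R : {perm {set C}}) p else p.

Lemma odot1 p : odot p 1%g = p.
Proof. by rewrite /odot; case: pickP => // R _; rewrite ffunE perm1. Qed.

Definition in_Q (t : C * prodG * prodG) : bool :=
  let: (X, d, g) := t in
  [&& X \in FF E, d \in GG, g \in GG
    & odot (classII X) (d^-1 * g)%g \in BB E].

Definition Qplus : finType := {t : C * prodG * prodG | in_Q t}.

(* The initial state iota is None. *)
Definition Qstate : finType := option Qplus.

Definition state_class (q : Qplus) : {set C} :=
  let: (X, d, g) := val q in odot (classII X) (d^-1 * g)%g.

Lemma state_class_BB (q : Qplus) : state_class q \in BB E.
Proof.
by rewrite /state_class; case: q => -[[X d] g] /= /and4P[].
Qed.

Definition qval (q : Qplus) : C :=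
  exist _ (unionII (state_class q)) (union_BB (state_class_BB q)).

Definition qlambda (s : S) (q : Qplus) : C * prodG :=
  let: (X, d, g) := val q in
  if eqR (qval q ** singC s) (qval q) && in_Q (X, d, (g * gs s)%g)
  then (X, d) else (overline E (qval q ** singC s), (g * gs s)%g).

Definition qgroup (q : Qplus) : prodG := (val q).2.

Lemma gs_GG s : gs s \in GG.
Proof. by apply: mem_gen; apply: imset_f. Qed.

Lemma in_Q_reset (X : C) (h : prodG) : h \in GG -> in_Q (overline E X, h, h).
Proof.
move=> Gh; rewrite /in_Q overline_FF Gh /= mulVg odot1.
by apply: imset_f; apply: overline_FF.
Qed.

Lemma in_Q_step (s : S) (q : Qplus) : in_Q (qlambda s q, (qgroup q * gs s)%g).
Proof.
have : (qgroup q * gs s)%g \in GG.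
  rewrite groupM ?gs_GG // /qgroup; by case: q => -[[X d] g] /= /and4P[].
rewrite /qlambda /qgroup; case: (val q) => -[X d] g /= Gg.
by case: ifP => [/andP[]//|_]; apply: in_Q_reset.
Qed.

Definition qstep (s : S) (q : Qstate) : Qstate :=
  match q with
  | None => Some (exist _ (overline E (singC s), gs s, gs s)
                          (in_Q_reset (singC s) (gs_GG s)))
  | Some q => Some (exist _ (qlambda s q, (qgroup q * gs s)%g) (in_Q_step s q))
  end.

Definition transition_sg : subsg (tfun Qstate) :=
  gen_sg [set tmk (qstep s) | s : S].

End Automaton.

(* Main.v *)
Require Import Defs.
From mathcomp Require Import all_boot all_fingroup.

(** Reading a letter s multiplies the group component of a state by g_s and
    never raises val in the R-order.  A step that leaves the R-class of val
    unchanged also leaves (X, d) unchanged: a reset would replace V = val.s by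
    Vk with k a product of idempotents, and if Vk is R-equivalent to V then it
    is type-II equivalent to V, so that [V] already lies in B and no reset was
    due.  An idempotent of the transition semigroup has trivial group component
    (look at the initial state), hence so does every product of idempotents.
    If x and y are R-equivalent in the idempotent-generated subsemigroup, then
    for each state q the states qx and qy are reachable from each other by such
    products, so they agree in all three components. *)

Set Implicit Arguments.
Unset Strict Implicit.
Unset Printing Implicit Defensive.

Local Open Scope sg_scope.

(** * The R-order and the type-II relation *)

Section GreenTypeII.
Variable T : finSemigroupType.
Implicit Types (x y z k : T) (a b : adjI T).

Lemma mulIA x a b : x **I a **I b = x **I (a ** b).
Proof. by case: a b => [a|] [b|] //=; rewrite smulA. Qed.

Lemma leRP x y : reflect (exists a, x = y **I a) (leR x y).
Proof.
by apply: (iffP existsP) => -[a]; [move/eqP-> | move->]; exists a.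
Qed.

Lemma leR_mulI x a : leR (x **I a) x.
Proof. by apply/leRP; exists a. Qed.

Lemma leR_trans y x z : leR x y -> leR y z -> leR x z.
Proof.
by move=> /leRP[a ->] /leRP[b ->]; apply/leRP; exists (b ** a); rewrite mulIA.
Qed.

Lemma group_kernelI_mem k :
  k \in group_kernel T -> (Some k : adjI T) \in group_kernelI T.
Proof. by move=> kk; rewrite 2!inE; apply/orP; right; apply: imset_f. Qed.

Lemma group_kernelIM a b :
  a \in group_kernelI T -> b \in group_kernelI T -> a ** b \in group_kernelI T.
Proof.
rewrite 2!inE => /orP[/eqP->|/imsetP[x kx ->]]; first by case: b.
rewrite 2!inE => /orP[/eqP->|/imsetP[y ky ->]]; first exact: group_kernelI_mem.
exact/group_kernelI_mem/group_kernelM.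
Qed.

Lemma eqIIP x y :
  reflect (exists a b, [/\ a \in group_kernelI T, b \in group_kernelI T,
                           x **I a = y & y **I b = x])
          (eqII x y).
Proof.
apply: (iffP exists_inP) => [[a ka /exists_inP[b kb]]|[a [b [ka kb xa yb]]]].
  by case/andP=> /eqP xa /eqP yb; exists a, b.
by exists a => //; apply/exists_inP; exists b; rewrite // xa yb !eqxx.
Qed.

Lemma eqII_sym x y : eqII x y -> eqII y x.
Proof. by case/eqIIP=> a [b [ka kb xa yb]]; apply/eqIIP; exists b, a. Qed.

Lemma eqII_trans y x z : eqII x y -> eqII y z -> eqII x z.
Proof.
case/eqIIP=> a [b [ka kb xa yb]] /eqIIP[a' [b' [ka' kb' ya' zb']]].
apply/eqIIP; exists (a ** a'), (b' ** b).
by rewrite -!mulIA xa ya' zb' yb; split=> //; apply: group_kernelIM.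
Qed.

Lemma eqII_leR x y : eqII x y -> leR y x.
Proof. by case/eqIIP=> a [b [_ _ <- _]]; apply: leR_mulI. Qed.

Lemma classII_eq x y : eqII x y -> classII x = classII y.
Proof.
move=> xy; apply/setP=> z; rewrite !inE.
by apply/idP/idP; apply: eqII_trans; rewrite // eqII_sym.
Qed.

Lemma classII_inj x y : classII x = classII y -> eqII x y.
Proof. by move=> /setP/(_ y); rewrite !inE eqII_refl. Qed.

(** If x = x k z, some power e of h = k z is idempotent and x e = x. The kernel contains every u
    with u k u = u, so such a u with k u = e leads back from x k to x. *)
Lemma eqII_mul_kernel x a :
  a \in group_kernelI T -> leR x (x **I a) -> eqII x (x **I a).
Proof.
rewrite 2!inE => /orP[/eqP-> _|/imsetP[k kk ->]]; first exact: eqII_refl.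
case/leRP=> -[z|] /= xkz; last by rewrite -xkz eqII_refl.
pose h := k ** z; have [n /eqP ee] := ex_idem_pow h; set e := spow h n in ee.
have xh m : x ** spow h m = x.
  by elim: m => [|m IH] /=; rewrite ?smulA -xkz.
(* The middle factor is h^(2n+1), so k u = h^(2n+2) e = e^3 = e; the last e gives u k u = u e =
   u. *)
pose u := z ** spow h (n + n) ** e.
have ku : k ** u = e.
  by rewrite /u !smulA -/h -[h ** _]/(spow h (n + n).+1) -spowD -/e !ee.
have Ku : u \in group_kernel T.
  by apply: group_kernel_weak kk _; rewrite -smulA ku /u -smulA ee.
apply/eqIIP; exists (Some k : adjI T), (Some u : adjI T).
by split; rewrite ?group_kernelI_mem //= -smulA ku xh.
Qed.

End GreenTypeII.

(** * Generated subsemigroups and composition of self-maps *)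

Lemma gen_set_ind (T : finSemigroupType) (A : {set T}) (P : pred T) :
  (forall x, x \in A -> P x) -> (forall x y, P x -> P y -> P (x ** y)) ->
  forall x, x \in gen_set A -> P x.
Proof.
move=> PA PM x /bigcapP/(_ [set y | P y]); rewrite inE; apply.
apply/andP; split; last by apply/subsetP=> y Ay; rewrite inE PA.
by apply/sg_closedP=> y z; rewrite !inE; apply: PM.
Qed.

Lemma tappM (Q : finType) (f g : tfun Q) q :
  tapp (f ** g) q = tapp g (tapp f q).
Proof. by rewrite [LHS]/tapp ffunE. Qed.

Lemma tapp_tmk (Q : finType) (f : Q -> Q) q : tapp (tmk f) q = f q.
Proof. by rewrite /tapp ffunE. Qed.

(** * [psi] and [overline] as multiplication by kernel elements *)

Section Overline.
Variables (S : finSemigroupType) (E : idem_choice S).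
Local Notation C := (sg_type (CER S)).
Implicit Types X : C.

Lemma psi_kernel X :
  exists2 a : adjI C, a \in group_kernelI C & psi E X = X **I a.
Proof.
case Ee: (EX E X) (EX_idem E X) => [e|] He; last first.
  exists None; first by rewrite !inE.
  by apply: val_inj; rewrite /= /psi_set Ee /omega spow_None.
pose B : C := exist _ (beta e) (CER_unionII (idem_Some He)).
have valB m : val (spow B m) = spow (beta e) m by elim: m => //= m ->.
(* [psi_set] takes its omega power in [{set S}^I]; the same exponent on [B] yields that power inside
   C, where it is idempotent and hence in the kernel. *)
pose k : C := spow B (ex_minn (ex_idem_pow (betaI (Some e)))).
have omE : omega (betaI (Some e)) = Some (val k).
  by rewrite /omega spow_Some valB.
exists (Some k); last by apply: val_inj; rewrite /= /psi_set Ee omE.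
apply/group_kernelI_mem/group_kernel_idem/eqP/val_inj.
by have := omega_idem (betaI (Some e)); rewrite omE => /eqP[].
Qed.

Lemma overline_kernel X :
  exists2 a : adjI C, a \in group_kernelI C & overline E X = X **I a.
Proof.
rewrite /overline /omega; elim: (ex_minn _) X => [|n IH] X /=.
  by rewrite tapp_tmk; apply: psi_kernel.
rewrite tappM tapp_tmk; have [a ka ->] := psi_kernel X.
have [b kb ->] := IH (X **I a).
by exists (a ** b); rewrite ?group_kernelIM // mulIA.
Qed.

Lemma leR_overline X : leR (overline E X) X.
Proof. by have [a _ ->] := overline_kernel X; apply: leR_mulI. Qed.

Lemma classII_overline_BB X : leR X (overline E X) -> classII X \in BB E.
Proof.
move=> le; rewrite (_ : classII X = classII (overline E X)); last first.
  apply: classII_eq; have [a ka Ea] := overline_kernel X.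
  by rewrite Ea in le *; apply: eqII_mul_kernel.
by apply: imset_f; apply: overline_FF.
Qed.

End Overline.

(** * The effect of one letter on a state *)

Section Steps.
Variables (S : finSemigroupType) (E : idem_choice S) (c : perm_choice S).
Local Notation C := (sg_type (CER S)).
Local Notation Qplus := (Qplus E c).
Local Notation prodG := (prodG E).
Implicit Types (q : Qplus) (h : prodG) (R : RRtype E).

(** The condition defines a subgroup of the product that contains the generators. *)
Lemma GG_perm_on h R : h \in GG E c -> perm_on (quotII (val R)) (h R).
Proof.
pose A := [set k : prodG | perm_on (quotII (val R)) (k R : {perm {set C}})].
have gA : group_set A.
  apply/group_setP; split=> [|k l]; first by rewrite inE ffunE perm_on1.
  by rewrite !inE ffunE; apply: perm_onM.
have: (<<[set gs E c s | s : S]>> \subset Group gA)%g.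
  rewrite gen_subG; apply/subsetP=> _ /imsetP[s _ ->]; rewrite inE ffunE.
  by have /imsetP[X _ ->] := valP R; apply: gsR_on.
by move/subsetP=> sub /sub; rewrite inE.
Qed.

(** The state class is that of some Y fixed by [psi], and the union of that class is Y itself. *)
Lemma classII_qval q : state_class q = classII (qval q).
Proof.
have /imsetP[Y FY pY] := state_class_BB q; rewrite [LHS]pY; congr classII.
by apply: val_inj; rewrite /= pY [unionII _](beta_FF FY).
Qed.

(** The partial action of s is defined at the class of val, and g_s extends it. *)
Lemma odot_gs q s : eqR (qval q ** singC s) (qval q) ->
  odot (classII (val q).1.1) ((val q).1.2^-1 * (qgroup q * gs E c s))%g
    = classII (qval q ** singC s).
Proof.
move=> eqRs; have Eq := classII_qval q; move: (qval q) Eq eqRs => V.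
rewrite /state_class /qgroup; case: q => -[[X d] g] /= /and4P[FX Gd Gg _].
have RX : Rclass X \in RR E by apply: imset_f.
pose R0 : RRtype E := exist (fun A => A \in RR E) _ RX.
(* [odot] picks R from the class of X alone, so the same R serves both group elements; [R0] shows
   that the pick succeeds. *)
rewrite mulgA /odot; case: pickP => [R XR|/(_ R0)/negP[]]; last first.
  by apply: imset_f; rewrite inE /eqR andbb; apply: (leR_mulI X None).
move=> pV eqRs; rewrite ffunE permM pV ffunE.
have /imsetP[Z FZ RZ] := valP R.
have pR : classII V \in quotII (val R).
  by rewrite -pV perm_closed // GG_perm_on // groupM ?groupV.
rewrite RZ in pR *; apply: (gsR_ext c pR).
have VV : V \in classII V by rewrite inE eqII_refl.
apply/exists_inP; exists V => //; rewrite eqxx andbT.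
(* The class of V is only known to be that of some W in R, so V is placed in R through W. *)
case/imsetP: pR VV => W; rewrite inE => /andP[WZ ZW] ->; rewrite inE => WV.
have [VW {}WV] := (eqII_leR WV, eqII_leR (eqII_sym WV)).
rewrite inE; case/andP: eqRs => sV Vs; apply/andP; split.
  exact: leR_trans sV (leR_trans VW WZ).
exact: leR_trans ZW (leR_trans WV Vs).
Qed.

(* val q = ((X, d), g), so the first projection is the pair fixed by the
   steps that are not resets. *)
Definition descends h q q' : bool :=
  [&& qgroup q' == (qgroup q * h)%g, leR (qval q') (qval q)
    & leR (qval q) (qval q') ==> ((val q').1 == (val q).1)].

Lemma descends_trans h h' q q' q'' :
  descends h q q' -> descends h' q' q'' -> descends (h * h')%g q q''.
Proof.
case/and3P=> /eqP g1 le1 /implyP st1 /and3P[/eqP g2 le2 /implyP st2].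
rewrite /descends g2 g1 mulgA eqxx (leR_trans le2 le1) /=; apply/implyP=> le.
have /eqP-> := st2 (leR_trans le1 le).
exact: st1 (leR_trans le le2).
Qed.

Lemma descends_qstep s q q' : qstep s (Some q) = Some q' ->
  descends (gs E c s) q q'.
Proof.
move=> [Eq']; have vq' : val q' = (qlambda s q, (qgroup q * gs E c s)%g).
  by rewrite -Eq'.
have gq' : qgroup q' = (qgroup q * gs E c s)%g by rewrite /qgroup vq'.
have cq' : classII (qval q') =
    odot (classII (val q').1.1) ((val q').1.2^-1 * qgroup q')%g.
  by rewrite -classII_qval /state_class /qgroup; case: (val q') => -[].
rewrite /descends gq' eqxx andTb; rewrite gq' in cq'.
have := odot_gs (s := s) (q := q); move: cq'; rewrite vq' /qlambda.
have : in_Q c (val q) by exact: valP.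
rewrite /qgroup; case: (val q) => -[X d] g /= inQ cq' odotE.
have le_s : leR (qval q ** singC s) (qval q).
  exact: (leR_mulI (qval q) (Some (singC s))).
case: ifP cq' => [/andP[eqRs _]|ninQ] /= cq'.
  rewrite eqxx implybT andbT; apply: leR_trans le_s.
  by apply/eqII_leR/classII_inj; rewrite cq' (odotE eqRs).
(* After a reset d = g, so the group element acting on the new class is 1. *)
have le' : eqII (overline E (qval q ** singC s)) (qval q').
  by apply: classII_inj; rewrite cq' mulVg odot1.
have le_o := leR_overline E (qval q ** singC s).
rewrite (leR_trans (eqII_leR le') (leR_trans le_o le_s)) /=.
(* If val did not drop, the class of val.s would lie in [BB], so keeping (X, d) was allowed,
   contrary to this branch. *)
apply/implyP=> le; have leo := leR_trans le (eqII_leR le').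
have eqRs : eqR (qval q ** singC s) (qval q).
  by rewrite /eqR le_s (leR_trans leo le_o).
case/negP: ninQ; rewrite eqRs /=; case/and4P: inQ => -> -> Gg _.
rewrite groupM ?gs_GG // (odotE eqRs).
exact: classII_overline_BB (leR_trans le_s leo).
Qed.

(** * Group values of transitions *)

Definition transition_type h (f : tfun (Qstate E c)) : bool :=
  (if tapp f None is Some q then qgroup q == h else false) &&
  [forall q, if tapp f (Some q) is Some q' then descends h q q' else false].

(** The first factor already leaves the initial state, so the second acts only on non-initial
    ones. *)
Lemma transition_typeM h h' f f' : transition_type h f ->
  transition_type h' f' -> transition_type (h * h')%g (f ** f').
Proof.
case/andP=> f0 /forallP fS /andP[_ /forallP fS'].
apply/andP; split.
  rewrite tappM; case: (tapp f None) f0 => // q /eqP <-.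
  by have := fS' q; case: (tapp f' (Some q)) => // q' /and3P[].
apply/forallP=> q; rewrite tappM; have := fS q.
case: (tapp f (Some q)) => [q' d1|//]; have := fS' q'.
by case: (tapp f' (Some q')) => [q''|//]; apply: descends_trans.
Qed.

Lemma transition_type_sg f :
  f \in sgset (transition_sg E c) -> exists h, transition_type h f.
Proof.
move=> Tf; suff: [exists h, transition_type h f] by move/existsP.
move: f Tf; apply: gen_set_ind => [_ /imsetP[s _ ->]|f f' /existsP[h fh] /existsP[h' fh']].
  apply/existsP; exists (gs E c s); rewrite /transition_type tapp_tmk /=.
  rewrite eqxx; apply/forallP=> q; rewrite tapp_tmk.
  exact: descends_qstep.
by apply/existsP; exists (h * h')%g; apply: transition_typeM.
Qed.

Lemma transition_type_idem h f :
  sg_idem f -> transition_type h f -> h = 1%g.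
Proof.
move=> /eqP ff fh; have := transition_typeM fh fh; rewrite ff.
case/andP: fh => f0 _ /andP[+ _].
case: (tapp f None) f0 => [q /eqP -> /eqP hh|//].
by apply: (mulgI h); rewrite mulg1 -hh.
Qed.

Lemma transition_type_unit (f : sg_type (transition_sg E c)) :
  f \in gen_set (idempotents _) -> transition_type 1%g (val f).
Proof.
move: f; apply: gen_set_ind => [f|f f' fh fh'].
  rewrite inE => /eqP/(congr1 val)/eqP idf.
  have [h fh] := transition_type_sg (valP f).
  by rewrite -(transition_type_idem idf fh).
by rewrite -[1%g]mulg1; apply: transition_typeM.
Qed.

Lemma descends_unit_antisym q q' :
  descends 1%g q q' -> descends 1%g q' q -> q = q'.
Proof.
case/and3P=> /eqP; rewrite mulg1 => g1 le1 /implyP st1 /and3P[_ le2 _].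
apply: val_inj; have := eqP (st1 le2); move: g1; rewrite /qgroup.
by case: (val q) => xd g; case: (val q') => xd' g' /= -> ->.
Qed.

Lemma transition_type_R_antisym h h' x y a b :
    transition_type h x -> transition_type h' y ->
    transition_type 1%g a -> transition_type 1%g b ->
  y ** a = x -> x ** b = y -> x = y.
Proof.
move=> xh yh /andP[_ /forallP aS] /andP[_ /forallP bS] ya xb.
(* Even from the initial state, x and y lead to non-initial states, where a and b can be compared by
   [descends]. *)
have some k f p : transition_type k f -> exists q, tapp f p = Some q.
  case/andP=> f0 /forallP fS; case: p => [q|].
    by have := fS q; case: (tapp f _) => [q'|//]; exists q'.
  by case: (tapp f _) f0 => [q'|//]; exists q'.
apply/ffunP=> p; have [[q xq] [q' yq']] := (some _ _ p xh, some _ _ p yh).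
have aq' : tapp a (Some q') = Some q by rewrite -yq' -tappM ya.
have bq : tapp b (Some q) = Some q' by rewrite -xq -tappM xb.
rewrite -[x p]/(tapp x p) -[y p]/(tapp y p) xq yq'; congr Some.
by apply: descends_unit_antisym; [have := bS q|have := aS q']; rewrite ?bq ?aq'.
Qed.

End Steps.

Theorem proposition8p6 (S : finSemigroupType)
  (E : idem_choice S) (c : perm_choice S) :
  in_ER (sg_type (transition_sg E c)).
Proof.
move=> x y /andP[/leRP[a xa] /leRP[b yb]].
(* If either multiplier is the adjoined identity, x = y at once. *)
case: a xa => [a|] xa //; case: b yb => [b|] yb //.
apply/val_inj/val_inj.
apply: (transition_type_R_antisym
  (transition_type_unit (valP x)) (transition_type_unit (valP y))
  (transition_type_unit (valP a)) (transition_type_unit (valP b))).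
  by rewrite xa.
by rewrite yb.
Qed.
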